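(* Let $\Lambda\neq\{0\}$ be a subgroup of the additive ordered group $\mathbb{R}$ and let $\lVert\cdot\rVert\colon F(a,b)\to\Lambda_{+}$ be a purely hyperbolic pseudo-length on the free group $F(a,b)$ over $\{a,b\}$. There exist an automorphism $\sigma$ of $F(a,b)$ and $\alpha,\beta,\gamma,\delta\in\Lambda$ satisfying (1) $\gamma-\alpha-\beta\in 2\Lambda$ and $\delta-\alpha-\beta\in 2\Lambda$, (2) either $\gamma=\delta>\alpha+\beta$ or $\max\{\gamma,\delta\}=\alpha+\beta$, (3) $\alpha>0$, $\beta>0$, and $|\alpha-\beta|<\min\{\gamma,\delta\}$, such that $$\lVert w\rVert=\lVert\sigma(w)\rVert_{\alpha,\beta,\gamma,\delta}\quad\text{for all } w\in F(a,b).$$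
   Context: $\Lambda_{+}:=\{\lambda\in\Lambda:\lambda\ge 0\}$ and $2\Lambda:=\{2\lambda:\lambda\in\Lambda\}$. A function $\lVert\cdot\rVert\colon G\to\Lambda_{+}$ on a group $G$ is a pseudo-length if: (A0) $\max\{0,\lVert gh\rVert-\lVert g\rVert-\lVert h\rVert\}\in 2\Lambda$ for any $g,h\in G$ with $\lVert g\rVert>0$, $\lVert h\rVert>0$; (A1) $\lVert ghg^{-1}\rVert=\lVert h\rVert$ for any $g,h\in G$; (A2) $\lVert gh\rVert=\lVert gh^{-1}\rVert$ or $\max\{\lVert gh\rVert,\lVert gh^{-1}\rVert\}\le\lVert g\rVert+\lVert h\rVert$, for any $g,h\in G$; (A3) $\lVert gh\rVert=\lVert gh^{-1}\rVert>\lVert g\rVert+\lVert h\rVert$ or $\max\{\lVert gh\rVert,\lVert gh^{-1}\rVert\}=\lVert g\rVert+\lVert h\rVert$, for any $g,h\in G$ with $\lVert g\rVert>0$, $\lVert h\rVert>0$. A pseudo-length is purely hyperbolic if $\lVert g\rVert>0$ for all $g\in G\setminus\{1\}$. For $\alpha,\beta,\gamma,\delta\in\Lambda$ satisfying (1), (2), (3) of the claim, $\lVert\cdot\rVert_{\alpha,\beta,\gamma,\delta}$ denotes the unique pseudo-length $F(a,b)\to\Lambda_{+}$ taking the values $\alpha,\beta,\gamma,\delta$ at $a$, $b$, $ab$, $ab^{-1}$, respectively (it exists and is unique). *)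

(* Defs.v *)
From HB Require Import structures.
From mathcomp Require Import all_boot all_order all_algebra.
From mathcomp Require Import boolp classical_sets reals.

Set Implicit Arguments.
Unset Strict Implicit.
Unset Printing Implicit Defensive.

Import Order.TTheory GRing.Theory Num.Theory.

(* Free group on T: a letter (x, s) is x when s = false and the inverse of x
   when s = true; the elements are the reduced words. *)
Section FreeGroup.
Variable T : choiceType.
Local Open Scope group_scope.

Definition letter : Type := (T * bool)%type.
Implicit Types (l : letter) (u v w : seq letter).

Definition linv l : letter := (l.1, ~~ l.2).

Definition reduced w : bool := sorted (fun l m => m != linv l) w.

Record freegroup := FreeGroup { fgword : seq letter; _ : reduced fgword }.

HB.instance Definition _ := [isSub for fgword].
HB.instance Definition _ := [Choice of freegroup by <:].

Definition lcons l w : seq letter :=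
  if w is m :: w' then if m == linv l then w' else l :: w else [:: l].

Definition rmul u v : seq letter := foldr lcons v u.

Definition rinv u : seq letter := rev (map linv u).

Lemma linvK : involutive linv.
Proof. by case=> x s; rewrite /linv /= negbK. Qed.

Lemma reduced_tl l w : reduced (l :: w) -> reduced w.
Proof. exact: path_sorted. Qed.

Lemma reduced_lcons l w : reduced w -> reduced (lcons l w).
Proof.
case: w => [//|m w] rw /=; case: eqVneq => [_|ne]; first exact: reduced_tl rw.
by rewrite /reduced /= ne.
Qed.

Lemma reduced_rmul u v : reduced v -> reduced (rmul u v).
Proof. by move=> rv; elim: u => //= l u; apply: reduced_lcons. Qed.

Lemma lconsK l w : reduced w ->
  lcons l (lcons (linv l) w) = w.
Proof.
case: w => [|m w] rw /=; first by rewrite eqxx.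
case: eqVneq => [|_] /=; last by rewrite eqxx.
rewrite linvK => em; case: w rw => [|k w] /=; first by rewrite em.
by rewrite /reduced /= em => /andP[/negbTE ->].
Qed.

Lemma lcons_reduced l w : reduced (l :: w) -> lcons l w = l :: w.
Proof. by case: w => //= m w; rewrite /reduced /= => /andP[/negbTE ->]. Qed.

Lemma rmul_lcons l u v : reduced u -> reduced v ->
  rmul (lcons l u) v = lcons l (rmul u v).
Proof.
case: u => [//|m u] ru rv /=; case: eqVneq => [->|//].
by rewrite lconsK // reduced_rmul.
Qed.

Lemma rmulA u v w : reduced v -> reduced w ->
  rmul u (rmul v w) = rmul (rmul u v) w.
Proof.
move=> rv rw; elim: u => //= l u ->.
by rewrite rmul_lcons // reduced_rmul.
Qed.

Lemma rmul_nil u : reduced u -> rmul u [::] = u.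
Proof.
elim: u => //= l u IH ru; rewrite IH ?(reduced_tl ru) //.
exact: lcons_reduced.
Qed.

Lemma reduced_rinv u : reduced u -> reduced (rinv u).
Proof.
rewrite /reduced /rinv rev_sorted sorted_map; apply: sub_sorted => l m /=.
by rewrite linvK; apply: contraNneq => ->.
Qed.

Lemma rinvK : involutive rinv.
Proof. by move=> u; rewrite /rinv map_rev revK mapK //; apply: linvK. Qed.

Lemma rmul_rinvK u v : reduced v -> rmul u (rmul (rinv u) v) = v.
Proof.
elim: u v => //= l u IH v rv.
rewrite /rinv /= rev_cons /rmul -cats1 foldr_cat /= -/(rmul _ _) -/(rmul _ _).
by rewrite IH ?reduced_lcons // lconsK.
Qed.

Lemma rmul_rinv u : reduced u -> rmul u (rinv u) = [::].
Proof.
by move=> ru; rewrite -[RHS](@rmul_rinvK u) // rmul_nil // reduced_rinv.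
Qed.

Definition fg_one : freegroup := @FreeGroup [::] isT.
Definition fg_mul (g h : freegroup) : freegroup :=
  FreeGroup (reduced_rmul (val g) (valP h)).
Definition fg_inv (g : freegroup) : freegroup := FreeGroup (reduced_rinv (valP g)).
Definition fg_gen (x : T) : freegroup := @FreeGroup [:: (x, false)] isT.

Fact fg_mulA : associative fg_mul.
Proof. by move=> g h k; apply: val_inj; rewrite /= rmulA ?(valP h, valP k). Qed.
Fact fg_mul1 : left_id fg_one fg_mul.
Proof. by move=> g; apply: val_inj. Qed.
Fact fg_mulr1 : right_id fg_one fg_mul.
Proof. by move=> g; apply: val_inj; rewrite /= rmul_nil ?(valP g). Qed.
Fact fg_mulrV : right_inverse fg_one fg_inv fg_mul.
Proof. by move=> g; apply: val_inj; rewrite /= rmul_rinv ?(valP g). Qed.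
Fact fg_mulV : left_inverse fg_one fg_inv fg_mul.
Proof.
move=> g; apply: val_inj => /=; rewrite -[X in rmul _ X]rinvK.
by rewrite rmul_rinv ?reduced_rinv ?(valP g).
Qed.

HB.instance Definition _ := isGroup.Build freegroup
  fg_mulA fg_mul1 fg_mulr1 fg_mulV fg_mulrV.

Section UniversalProperty.
Variables (H : groupType) (f : T -> H).

Definition eval_letter l : H := if l.2 then (f l.1)^-1 else f l.1.

Definition fg_lift (g : freegroup) : H :=
  foldr (fun l z => eval_letter l * z) 1 (val g).

Lemma fg_lift_gen x : fg_lift (fg_gen x) = f x.
Proof. by rewrite /fg_lift /= mulg1. Qed.

Lemma fg_liftM : {morph fg_lift : g h / g * h}.
Proof.
have eV l : eval_letter (linv l) = (eval_letter l)^-1.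
  by case: l => x [] //=; rewrite /eval_letter /= invgK.
pose ev w := foldr (fun l z => eval_letter l * z) 1 w.
have evc l w : ev (lcons l w) = eval_letter l * ev w.
  case: w => [//|m w] /=; case: eqVneq => [->|//].
  by rewrite eV mulVKg.
move=> g h; rewrite /fg_lift /= -!/(ev _).
by elim: (val g) => [|l u IH] /=; rewrite ?mul1g // evc IH mulgA.
Qed.

HB.instance Definition _ := isMultiplicative.Build freegroup H fg_lift fg_liftM.

Lemma fg_lift_unique (phi : {multiplicative freegroup -> H}) :
  (forall x, phi (fg_gen x) = f x) -> phi =1 fg_lift.
Proof.
move=> phif.
have phi1 : phi 1 = 1 by apply: (mulgI (phi 1)); rewrite -gmulfM !mulg1.
have phiV g : phi g^-1 = (phi g)^-1.
  by apply: (mulgI (phi g)); rewrite -gmulfM !mulgV phi1.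
case=> w; elim: w => [|[x s] w IH] rw.
  by rewrite -[RHS]phi1; congr (phi _); apply: val_inj.
have -> : FreeGroup rw =
    (if s then (fg_gen x)^-1 else fg_gen x) * FreeGroup (reduced_tl rw).
  by apply: val_inj; case: s rw => rw; rewrite /= lcons_reduced.
rewrite fg_liftM gmulfM IH; congr (_ * _); rewrite /fg_lift.
by case: s {rw}; rewrite /= mulg1 /eval_letter /= ?phiV phif.
Qed.

End UniversalProperty.

End FreeGroup.

Definition F2 : groupType := freegroup bool.
Definition gen_a : F2 := fg_gen false.
Definition gen_b : F2 := fg_gen true.

Local Open Scope ring_scope.

Section PseudoLength.
Variables (R : realType) (Lambda : zmodClosed R).

Definition in_double (x : R) : Prop := exists2 y, y \in Lambda & x = 2 * y.

Record pseudo_length (G : groupType) (len : G -> R) : Prop := PseudoLength {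
  pl_in : forall g, len g \in Lambda;
  pl_ge0 : forall g, 0 <= len g;
  pl_A0 : forall g h, 0 < len g -> 0 < len h ->
    in_double (Num.max 0 (len (g * h)%g - len g - len h));
  pl_A1 : forall g h, len (g * h * g^-1)%g = len h;
  pl_A2 : forall g h,
    len (g * h)%g = len (g * h^-1)%g \/
    Num.max (len (g * h)%g) (len (g * h^-1)%g) <= len g + len h;
  pl_A3 : forall g h, 0 < len g -> 0 < len h ->
    (len (g * h)%g = len (g * h^-1)%g /\ len g + len h < len (g * h)%g) \/
    Num.max (len (g * h)%g) (len (g * h^-1)%g) = len g + len h }.

Definition purely_hyperbolic (G : groupType) (len : G -> R) : Prop :=
  forall g, g <> 1%g -> 0 < len g.

Definition admissible (alpha beta gamma delta : R) : Prop :=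
  [/\ in_double (gamma - alpha - beta) /\ in_double (delta - alpha - beta),
      (gamma = delta /\ alpha + beta < gamma) \/
        Num.max gamma delta = alpha + beta
    & [/\ 0 < alpha, 0 < beta & `|alpha - beta| < Num.min gamma delta]].

(* Definite description: the pseudo-length on F2 taking the values alpha, beta,
   gamma, delta at a, b, ab, ab^-1 exists and is unique when these parameters
   are admissible elements of Lambda.  The default value 0 of [xget] is only
   reached when no such pseudo-length exists. *)
Definition length_of (alpha beta gamma delta : R) : F2 -> R :=
  xget (fun=> 0) [set len : F2 -> R | pseudo_length len /\
    [/\ len gen_a = alpha, len gen_b = beta,
        len (gen_a * gen_b)%g = gamma & len (gen_a * gen_b^-1)%g = delta]].

End PseudoLength.

(* Main.v *)
Require Import Defs.
From mathcomp Require Import all_boot all_order all_algebra.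
From mathcomp Require Import boolp classical_sets reals.
From mathcomp Require Import lra.

(** Existence is a form of Euclid's algorithm.  If a basis (x, y)
    with |y| <= |x| violates the inequality in (3), then |xy| or |xy^-1| is at
    most |x| - |y|, and one replaces x by this product.  Since the values of the
    length function may be dense, termination needs an invariant: the commutator
    [x, y] is not affected by these moves, and its length, which is positive, is
    at most 2 |x| whenever (3) fails.  Hence the larger of the two lengths stays
    bounded away from 0, and only finitely many subtractions are possible.

    Uniqueness follows from an explicit formula: on a cyclically reduced word the
    length is the sum of the lengths of the letters and of a weight for each pair
    of cyclically adjacent letters.  If some letter x occurs twice, the word is a
    product gh with g = x u and h = x v; then gh^-1 is conjugate to the shorter
    word u v^-1, whose length is less than |g| + |h|, so that (A3) yields
    |gh| = |g| + |h|.  The words without repeated letters are, up to cyclic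
    rotation, letters, products of two letters, and commutators of two letters. *)

Local Open Scope ring_scope.

Set Implicit Arguments.
Unset Strict Implicit.
Unset Printing Implicit Defensive.

Import Order.TTheory GRing.Theory Num.Theory.

Definition commutator (G : groupType) (g h : G) : G := (g * h * g^-1 * h^-1)%g.

(** The last inequality of condition (3), for an arbitrary pair in place of the generators. *)
Definition reduced_pair (R : realType) (G : groupType) (len : G -> R) x y :=
  `|len x - len y| < Num.min (len (x * y)%g) (len (x * y^-1)%g).

(** * Consequences of the axioms in an arbitrary group *)

Section PseudoLengthTheory.
Variables (R : realType) (Lambda : zmodClosed R) (G : groupType) (len : G -> R).
Hypothesis len_pl : pseudo_length Lambda len.

Let ge0 g : 0 <= len g. Proof. exact: pl_ge0 len_pl g. Qed.

Lemma plen_max_eq (g h : G) : 0 < len g -> 0 < len h ->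
  [\/ len (g * h)%g = len (g * h^-1)%g /\ len g + len h < len (g * h)%g,
      len (g * h)%g = len g + len h /\ len (g * h^-1)%g <= len g + len h
    | len (g * h^-1)%g = len g + len h /\ len (g * h)%g <= len g + len h].
Proof.
move=> g0 h0; case: (pl_A3 len_pl g0 h0) => [H|]; first by constructor 1.
rewrite maxEle; case: ifPn => [H <-|]; first by apply: Or33.
by rewrite -ltNge => /ltW H <-; apply: Or32.
Qed.

Lemma plenM_of_lt (g h : G) : 0 < len g -> 0 < len h ->
  len (g * h^-1)%g < len g + len h -> len (g * h)%g = len g + len h.
Proof. by move=> g0 h0 H; case: (plen_max_eq g0 h0) => -[H1 H2]; lra. Qed.

Lemma plenM_of_gt (g h : G) : len g + len h < len (g * h^-1)%g ->
  len (g * h)%g = len (g * h^-1)%g.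
Proof.
move=> H; case: (pl_A2 len_pl g h) => //.
by rewrite ge_max => /andP[_]; lra.
Qed.

Lemma plen1 : len 1%g = 0.
Proof.
apply/eqP; rewrite eq_le ge0 andbT leNgt; apply/negP => p.
by have := plen_max_eq p p; rewrite invg1 !mulg1; case=> -[]; lra.
Qed.

Lemma plenV (g : G) : len g^-1%g = len g.
Proof.
have V h : len h^-1%g = len h \/ len h^-1%g <= len h.
  case: (pl_A2 len_pl 1%g h); rewrite !mul1g; first by left.
  by rewrite plen1 add0r ge_max => /andP[_]; right.
have := V g; have := V g^-1%g; rewrite invgK.
move=> [-> //|A] [//|B]; apply/eqP; rewrite eq_le; lra.
Qed.

Lemma plenC (g h : G) : len (g * h)%g = len (h * g)%g.
Proof. by rewrite -[RHS](pl_A1 len_pl h^-1%g) !gnorm. Qed.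

Lemma plen_sqr (g : G) : len (g * g)%g = 2 * len g.
Proof.
have := ge0 g; rewrite le_eqVlt => /predU1P[z|p].
  case: (pl_A2 len_pl g g); rewrite mulgV plen1; first lra.
  by rewrite ge_max -z => /andP[A _]; have := ge0 (g * g)%g; lra.
by rewrite plenM_of_lt ?mulgV ?plen1; lra.
Qed.

Lemma plen_commV (g h : G) : len (commutator h g) = len (commutator g h).
Proof. by rewrite -plenV /commutator !gnorm. Qed.

Lemma plen_comm_Vr (g h : G) : len (commutator g h^-1%g) = len (commutator g h).
Proof.
by rewrite -plen_commV /commutator -[RHS](pl_A1 len_pl h^-1%g) !gnorm.
Qed.

(** Up to conjugation the commutator is the product of [h^-1 g] and [h g^-1], both of length at most
    [|g| - |h|]. When (A2) does not bound this product by the sum, it replaces it by [g (g h^-2)],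
    up to conjugation; a second use of (A2) leaves the bound [2 |g|] or the length [2 |h|] of a
    conjugate of [h^2]. *)
Lemma plen_comm_le (g h : G) : len (g * h^-1)%g <= len g - len h ->
  len (commutator g h) <= 2 * len g.
Proof.
move=> H; have h0 := ge0 h; have g0 := ge0 g.
have -> : len (commutator g h) = len ((h^-1 * g) * (h * g^-1))%g.
  by rewrite plenC /commutator !gnorm plenC !gnorm.
have Hl : len (h^-1 * g)%g <= len g - len h by rewrite plenC.
have Hr : len (h * g^-1)%g <= len g - len h by rewrite -plenV !gnorm.
case: (pl_A2 len_pl (h^-1 * g)%g (h * g^-1)%g) => [->|]; last first.
  by rewrite ge_max => /andP[A _]; lra.
have -> : len (h^-1 * g * (h * g^-1)^-1)%g = len (g * (g * h^-1 * h^-1))%g.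
  by rewrite -[RHS](pl_A1 len_pl h^-1%g) !gnorm.
have B : len (g * h^-1 * h^-1)%g <= len g.
  case: (pl_A2 len_pl (g * h^-1)%g h^-1%g) => [->|]; first by rewrite !gnorm.
  by rewrite ge_max plenV => /andP[A _]; lra.
case: (pl_A2 len_pl g (g * h^-1 * h^-1)%g) => [->|]; last first.
  by rewrite ge_max => /andP[A _]; lra.
have -> : (g * (g * h^-1 * h^-1)^-1 = g * (h * h) * g^-1)%g by rewrite !gnorm.
by rewrite (pl_A1 len_pl) plen_sqr; have := ge0 (g * h^-1)%g; lra.
Qed.

Section Commutator.
Variables g h : G.
Hypotheses (g0 : 0 < len g) (h0 : 0 < len h).
Hypothesis lt_g : 2 * len g < len (g * h)%g + len (g * h^-1)%g.
Hypothesis lt_h : 2 * len h < len (g * h)%g + len (g * h^-1)%g.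
Hypotheses (gh0 : 0 < len (g * h)%g) (ghV0 : 0 < len (g * h^-1)%g).

(** The product is [(gh)(gh^-1)], while [gh (gh^-1)^-1] is conjugate to [h^2], which is short enough
    by [lt_h]. *)
Lemma plen_conj_mul :
  len (g * (h * g * h^-1))%g = len (g * h)%g + len (g * h^-1)%g.
Proof.
have -> : (g * (h * g * h^-1) = g * h * (g * h^-1))%g by rewrite !gnorm.
rewrite plenM_of_lt //.
have -> : (g * h * (g * h^-1)^-1 = g * (h * h) * g^-1)%g by rewrite !gnorm.
by rewrite (pl_A1 len_pl) plen_sqr.
Qed.

(** Inverting the factor [h g^-1 h^-1] gives the preceding product, longer than [2 |g|] by [lt_g];
    then (A2) forces the two lengths to agree. *)
Lemma plen_comm : len (commutator g h) = len (g * h)%g + len (g * h^-1)%g.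
Proof.
have -> : (commutator g h = g * (h * g^-1 * h^-1))%g.
  by rewrite /commutator !gnorm.
have E : (g * (h * g^-1 * h^-1)^-1 = g * (h * g * h^-1))%g by rewrite !gnorm.
rewrite plenM_of_gt E plen_conj_mul //.
by rewrite (pl_A1 len_pl) plenV -mulr2n -mulr_natl.
Qed.

End Commutator.

End PseudoLengthTheory.

(** * Cyclic words and free reduction *)

Section CyclicWords.
Implicit Types (l m x y z : letter bool) (s t u v w : seq (letter bool)).

Definition letter_val l : F2 := eval_letter (@fg_gen bool) l.

Definition word_val w : F2 := foldr (fun l g => letter_val l * g)%g 1%g w.

Definition cyclically_reduced w := cycle (fun l m => m != linv l) w.

Lemma letter_valV l : letter_val (linv l) = (letter_val l)^-1%g.
Proof. by case: l => x [] //=; rewrite /letter_val /eval_letter /= invgK. Qed.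

Lemma word_val_cat s t : word_val (s ++ t) = (word_val s * word_val t)%g.
Proof. by elim: s => [|l s IH] /=; rewrite ?mul1g // IH mulgA. Qed.

Lemma word_val_rinv w : word_val (rinv w) = (word_val w)^-1%g.
Proof.
elim: w => [|l w IH]; first by rewrite invg1.
rewrite /rinv map_cons rev_cons -cats1 word_val_cat /= mulg1 letter_valV.
by rewrite invgM -IH.
Qed.

Lemma word_val_fgword (g : F2) : word_val (val g) = g.
Proof.
exact/esym/(@fg_lift_unique bool F2 (@fg_gen bool) idfun (fun=> erefl) g).
Qed.

Lemma unsplit_path (e : rel (letter bool)) x s : ~~ path e x s ->
  exists s1 y z s2, x :: s = s1 ++ [:: y, z & s2] /\ ~~ e y z.
Proof.
elim: s x => //= y s IH x; rewrite negb_and => /orP[H|/IH].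
  by exists [::], x, y, s.
by move=> [s1 [y' [z [s2 [-> H]]]]]; exists (x :: s1), y', z, s2.
Qed.

Lemma not_cyclically_reducedP w : ~~ cyclically_reduced w ->
  exists x s t u, [/\ w = t ++ u & u ++ t = [:: x, linv x & s]].
Proof.
case: w => // x p /unsplit_path[s1 [y [z [s2 [E]]]]].
rewrite negbK => /eqP zE; subst z; case/lastP: s2 E => [|s2 z].
  (* The cancelling pair consists of the last and the first letter of the word. *)
  rewrite -(cat1s (linv y)) -[_ :: rcons p x]/(rcons (x :: p) x).
  rewrite -cat_rcons cats1 => /rcons_inj[E xE].
  case: s1 E => [|x' s1] /= [xx pE].
    by case: (y) xE xx => a b -> [/eqP]; case: b.
  by exists y, s1, (x :: s1), [:: y]; rewrite pE -cats1 /= xE.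
rewrite -[_ :: rcons p x]/(rcons (x :: p) x) -!rcons_cons -rcons_cat.
move=> /rcons_inj[E _].
by exists y, (s2 ++ s1), s1, [:: y, linv y & s2].
Qed.

Lemma not_uniqP (w : seq (letter bool)) : ~~ uniq w ->
  exists x s t u, w = s ++ x :: t ++ x :: u.
Proof.
elim: w => //= x w IH; rewrite negb_and negbK => /orP[|/IH].
  by case/splitPr=> t u; exists x, [::], t, u.
by move=> [y [s [t [u ->]]]]; exists y, (x :: s), t, u.
Qed.

Lemma cyclically_reduced_catC s t :
  cyclically_reduced (s ++ t) = cyclically_reduced (t ++ s).
Proof. by rewrite /cyclically_reduced -(rot_cycle (size s)) rot_size_cat. Qed.

(** Cutting a cyclic word at two occurrences of one letter creates no new turn: the two short cycles
    share out the turns of the long one. *)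
Lemma cyclically_reduced_split x u v :
  cyclically_reduced (x :: u ++ x :: v) =
  cyclically_reduced (x :: u) && cyclically_reduced (x :: v).
Proof.
rewrite /cyclically_reduced /= rcons_cat cat_path /= -!cats1 !cat_path /=.
by rewrite !andbT; do ![case: (path _ _ _)]; rewrite //= ?andbF.
Qed.

(** Rotating a word conjugates its value, and a cancelling pair brought to the front can be removed;
    induction on the size. *)
Lemma conj_cyclically_reduced (g : F2) :
  exists k w, cyclically_reduced w /\ g = (k * word_val w * k^-1)%g.
Proof.
rewrite -(word_val_fgword g); move: (val g) => /= w.
elim: {w}(size w) {-2}w (leqnn (size w)) => [|n IH] w.
  by case: w => // _; exists 1%g, [::]; rewrite !gnorm.
move=> wn; case: (boolP (cyclically_reduced w)) => [cw|].
  by exists 1%g, w; rewrite !gnorm.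
move=> /not_cyclically_reducedP[x [s [t [u [wE E]]]]]; subst w.
have sn : (size s <= n)%N.
  by move: wn; rewrite size_cat addnC -size_cat E /= => /ltnW.
have [k [w [cw sE]]] := IH s sn.
exists (word_val t * k)%g, w; split=> //.
have : word_val (u ++ t) = word_val s.
  by rewrite E /= letter_valV !gnorm.
rewrite !word_val_cat sE => uE.
transitivity (word_val t * (word_val u * word_val t) * (word_val t)^-1)%g.
  by rewrite !gnorm.
by rewrite uE !gnorm.
Qed.
End CyclicWords.

(** * Weights of cyclic words and the length formula *)

Section CyclicLength.
Variables (R : realType) (al be C D E : R).
Implicit Types (l m x y z : letter bool) (s t u v w : seq (letter bool)).

Definition letter_wt x : R := if x.1 then be else al.

(* [C] and [D] are half of [|ab| - |a| - |b|] and of [|ab^-1| - |a| - |b|], as the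
   words ab and ab^-1 require, and [E] is the largest of 0, [- C] and [- D]; the
   weight [- E] of a backtracking turn makes free reduction decrease the total. *)
Definition turn_wt x y : R :=
  if x.1 == y.1 then if x.2 == y.2 then 0 else - E
  else if x.2 == y.2 then C else D.

(** The endpoint [z] contributes only the turn into it, so that weights add under concatenation and
    a cycle is a path back to its first letter. *)
Fixpoint path_wt x s z : R :=
  if s is y :: s' then letter_wt x + turn_wt x y + path_wt y s' z
  else letter_wt x + turn_wt x z.

Definition cyclic_wt w : R := if w is x :: s then path_wt x s x else 0.

Lemma path_wt_cat x s y t z :
  path_wt x (s ++ y :: t) z = path_wt x s y + path_wt y t z.
Proof. by elim: s x => //= x' s IH x; rewrite IH addrA. Qed.

Lemma path_wt_last x s z z' :
  path_wt x s z = path_wt x s z' + turn_wt (last x s) z - turn_wt (last x s) z'.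
Proof. by elim: s x => [|y s IH] x /=; [lra | rewrite IH; lra]. Qed.

Lemma turn_wtV x y : turn_wt (linv y) (linv x) = turn_wt x y.
Proof. by case: x => -[] []; case: y => -[] []. Qed.

Lemma path_wt_rinv x s z z' :
  path_wt (linv (last x s)) (rinv (belast x s)) z =
  path_wt x s z' - turn_wt (last x s) z' + turn_wt (linv x) z.
Proof.
elim: s x z => [|y s IH] x z /=; first by rewrite /letter_wt /=; lra.
rewrite /rinv map_cons rev_cons -cats1 path_wt_cat -/(rinv _) IH turn_wtV /=.
by rewrite /letter_wt /=; lra.
Qed.

Lemma cyclic_wt_catC s t : cyclic_wt (s ++ t) = cyclic_wt (t ++ s).
Proof.
case: s t => [|x s] [|y t]; rewrite ?cats0 //=.
by rewrite !path_wt_cat addrC.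
Qed.

Lemma cyclic_wt_split x u v :
  cyclic_wt (x :: u ++ x :: v) = cyclic_wt (x :: u) + cyclic_wt (x :: v).
Proof. exact: path_wt_cat. Qed.

Hypotheses (E0 : 0 <= E) (Eal : E < al) (Ebe : E < be).
Hypotheses (EC : - E <= C) (ED : - E <= D) (ECD : - E <= C + D).
Hypotheses (CD : C - D <= E) (DC : D - C <= E).

Ltac wt_lra := move: E0 Eal Ebe EC ED ECD CD DC => *; lra.

Lemma cyclic_wt_gt0 x s : 0 < cyclic_wt (x :: s).
Proof.
have pos y z : 0 < letter_wt y + turn_wt y z.
  by case: y => -[] []; case: z => -[] [];
    rewrite /letter_wt /turn_wt /=; wt_lra.
rewrite /=; move: {2}x => z.
by elim: s x => //= y s IH x; rewrite addr_gt0.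
Qed.

Lemma cyclic_wt_backtrack x s : cyclic_wt s < cyclic_wt [:: x, linv x & s].
Proof.
case: s => [|y s] /=.
  by case: x => -[] []; rewrite /letter_wt /turn_wt /=; wt_lra.
rewrite (path_wt_last y s y x); move: (path_wt _ _ _) (last _ _) => P z.
by case: x => -[] []; case: y => -[] []; case: z => -[] [];
  rewrite /letter_wt /turn_wt /=; wt_lra.
Qed.

Lemma turn_wt_triangle x y z : y != linv x -> z != linv x ->
  turn_wt y (linv z) - E <= turn_wt y x + turn_wt z x.
Proof.
by case: x => -[] []; case: y => -[] [] //; case: z => -[] [] // _ _;
  rewrite /turn_wt /=; wt_lra.
Qed.

Lemma cyclically_reduced_last x s : cyclically_reduced (x :: s) ->
  last x s != linv x.
Proof.
rewrite /cyclically_reduced /= rcons_path => /andP[_].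
by apply: contraNneq => ->; rewrite linvK.
Qed.

(** Inversion preserves the weights of turns, so only the turns at the two junctions change. The
    turn from [linv x] to [x] weighs [- E], and [turn_wt_triangle] compares the rest. *)
Lemma cyclic_wt_mulV x u v :
  cyclically_reduced (x :: u) -> cyclically_reduced (x :: v) ->
  cyclic_wt (x :: u ++ rinv (x :: v)) <=
  cyclic_wt (x :: u) + cyclic_wt (x :: v).
Proof.
move=> /cyclically_reduced_last Hu /cyclically_reduced_last Hv.
have -> : rinv (x :: v) = linv (last x v) :: rinv (belast x v).
  by rewrite lastI /rinv map_rcons rev_rcons.
rewrite /= path_wt_cat (path_wt_rinv _ _ _ x).
rewrite (path_wt_last _ _ _ x).
have := turn_wt_triangle Hu Hv.
have -> : turn_wt (linv x) x = - E by case: x {Hu Hv} => -[] [].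
by lra.
Qed.

Section Main.
Variables (Lambda : zmodClosed R) (len : F2 -> R).
Hypothesis len_pl : pseudo_length Lambda len.
Hypotheses (lena : len gen_a = al) (lenb : len gen_b = be).
Hypothesis lenab : len (gen_a * gen_b)%g = al + be + 2 * C.
Hypothesis lenaVb : len (gen_a * gen_b^-1)%g = al + be + 2 * D.

Lemma plen_letter x : len (letter_val x) = letter_wt x.
Proof.
by case: x => -[] []; rewrite /letter_val /eval_letter /letter_wt /=
  ?(plenV len_pl).
Qed.

(** Up to rotation and inversion the product is [ab] or [ab^-1]. *)
Lemma plen_letter2 x y : x.1 != y.1 ->
  len (letter_val x * letter_val y)%g = al + be + 2 * turn_wt x y.
Proof.
have ba : len (gen_b * gen_a)%g = al + be + 2 * C by rewrite (plenC len_pl).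
have bVa : len (gen_b * gen_a^-1)%g = al + be + 2 * D.
  by rewrite -(plenV len_pl) !gnorm.
case: x => -[] []; case: y => -[] [] // _;
  rewrite /turn_wt /letter_val /eval_letter /=
  -?/gen_a -?/gen_b ?ba ?bVa -?lenab -?lenaVb //.
- by rewrite -invgM (plenV len_pl).
- exact: (plenC len_pl).
- by rewrite -invgM (plenV len_pl) (plenC len_pl).
- by rewrite (plenC len_pl) bVa lenaVb.
Qed.

(** The inequalities required by [plen_comm] follow from [- E <= C + D] and from [E] being less than
    [al] and [be]. *)
Lemma plen_letter_comm x y : x.1 != y.1 ->
  len (commutator (letter_val x) (letter_val y)) =
  cyclic_wt [:: x; y; linv x; linv y].
Proof.
move=> xy; have xVy : x.1 != (linv y).1 by [].
have := plen_letter2 xy; have := plen_letter2 xVy; rewrite letter_valV => E1 E2.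
have l1 := plen_letter x; have l2 := plen_letter y.
by rewrite (plen_comm len_pl) ?E1 ?E2 ?l1 ?l2 /=;
  move: xy; case: x {xVy E1 E2 l1 l2} => -[] []; case: y => -[] [] // _;
  rewrite /letter_wt /turn_wt /=; wt_lra.
Qed.

Lemma plen_word_uniq w : cyclically_reduced w -> uniq w ->
  len (word_val w) = cyclic_wt w.
Proof.
move=> cw uw; have : (size w <= 4)%N.
  by have := max_card (mem w); rewrite (card_uniqP uw) card_prod card_bool.
case: w cw uw => [|x [|y [|z [|t []]]]] //=.
- by rewrite (plen1 len_pl).
- rewrite mulg1 plen_letter => _ _ _.
  by case: x => -[] []; rewrite /letter_wt /turn_wt /=; wt_lra.
- move=> cw uw _.
  have xy : x.1 != y.1 by move: cw uw; case: x => -[] []; case: y => -[] [].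
  rewrite mulg1 plen_letter2 //; move: xy.
  by case: x {cw uw} => -[] []; case: y => -[] [] // _;
    rewrite /letter_wt /turn_wt /=; wt_lra.
(* Among three distinct letters two are mutually inverse, and in a cyclic word of size three any two
   letters are adjacent. *)
- by case: x => -[] []; case: y => -[] [] //=; case: z => -[] [].
move=> cw uw _.
have [xy zE tE] : [/\ x.1 != y.1, z = linv x & t = linv y].
  by move: cw uw; case: x => -[] []; case: y => -[] [] //=; case: z => -[] [];
    case: t => -[] [].
by rewrite zE tE !letter_valV mulg1 !mulgA plen_letter_comm.
Qed.

(** The strict inequality is carried along in the induction because it supplies the hypothesis on
    [gh^-1] in [plenM_of_lt]. *)
Lemma plen_word w :
  (cyclically_reduced w -> len (word_val w) = cyclic_wt w) /\
  (~~ cyclically_reduced w -> len (word_val w) < cyclic_wt w).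
Proof.
elim: {w}(size w) {-2}w (leqnn (size w)) => [|n IH] w.
  by case: w => // _; split=> // _; rewrite (plen1 len_pl).
have le s : (size s <= n)%N -> len (word_val s) <= cyclic_wt s.
  by case/IH; case: (cyclically_reduced s) => [/(_ isT) -> //|_ /(_ isT)/ltW].
(* Cancellation lowers the size, so this half already holds at size [n.+1], the size of the word for
   [gh^-1] below. *)
have lt s : (size s <= n.+1)%N -> ~~ cyclically_reduced s ->
    len (word_val s) < cyclic_wt s.
  move=> sn /not_cyclically_reducedP[x [s' [t [u [sE E']]]]]; subst s.
  rewrite word_val_cat (plenC len_pl) -word_val_cat cyclic_wt_catC E' /=.
  rewrite letter_valV mulVKg.
  apply: le_lt_trans (cyclic_wt_backtrack _ _); apply: le.
  by move: sn; rewrite size_cat addnC -size_cat E' => /ltnW.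
move=> wn; split; last exact: lt.
move=> cw; case: (boolP (uniq w)) => [|/not_uniqP]; first exact: plen_word_uniq.
move=> [x [s [t [u wE]]]]; subst w.
move: cw wn; rewrite cyclically_reduced_catC cyclic_wt_catC.
rewrite size_cat addnC -size_cat.
rewrite word_val_cat (plenC len_pl) -word_val_cat cat_cons -catA cat_cons.
move: (u ++ s) => v {u s} cw wn; rewrite (cyclic_wt_split x t v).
move: cw; rewrite cyclically_reduced_split => /andP[ct cv].
have [vn tn] : (size v < n)%N /\ (size t < n)%N.
  by move: wn; rewrite /= size_cat /= addnS ltnS => H; split;
    apply: leq_trans H; rewrite ltnS ?leq_addl ?leq_addr.
have Et := (IH (x :: t) tn).1 ct; have Ev := (IH (x :: v) vn).1 cv.
rewrite -[x :: t ++ _]/((x :: t) ++ _) word_val_cat.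
rewrite -Et -Ev (plenM_of_lt len_pl) ?Et ?Ev ?cyclic_wt_gt0 //.
apply: lt_le_trans (cyclic_wt_mulV ct cv).
rewrite -word_val_rinv -word_val_cat; apply: lt.
  by move: wn; rewrite /= !size_cat size_rev size_map.
rewrite cyclically_reduced_catC /rinv map_cons rev_cons cat_rcons.
by rewrite cyclically_reduced_catC /cyclically_reduced /= linvK eqxx.
Qed.

End Main.
End CyclicLength.

(** * Homomorphisms and bases of the free group *)

Section Morphism.
Variables (G H : groupType) (phi : {multiplicative G -> H}).
Local Open Scope group_scope.

Lemma multiplicative1 : phi 1 = 1.
Proof. by apply: (mulgI (phi 1)); rewrite -gmulfM !mulg1. Qed.

Lemma multiplicativeV g : phi g^-1 = (phi g)^-1.
Proof. by apply: (mulgI (phi g)); rewrite -gmulfM !mulgV multiplicative1. Qed.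

End Morphism.

Section Bases.

Definition is_basis (x y : F2) := exists phi psi : {multiplicative F2 -> F2},
  [/\ cancel phi psi, cancel psi phi, phi gen_a = x & phi gen_b = y].

Definition pair_fun (x y : F2) (c : bool) : F2 := if c then y else x.

Definition F2_lift (x y : F2) : {multiplicative F2 -> F2} :=
  fg_lift (pair_fun x y).

Lemma F2_lift_a x y : F2_lift x y gen_a = x.
Proof. exact: (fg_lift_gen (pair_fun x y) false). Qed.

Lemma F2_lift_b x y : F2_lift x y gen_b = y.
Proof. exact: (fg_lift_gen (pair_fun x y) true). Qed.

Lemma F2_hom_id (phi : {multiplicative F2 -> F2}) :
  phi gen_a = gen_a -> phi gen_b = gen_b -> phi =1 id.
Proof.
move=> pa pb g; rewrite (fg_lift_unique (f := @fg_gen bool)); last by case.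
exact/esym/(fg_lift_unique (phi := idfun)).
Qed.

Lemma is_basis_gen : is_basis gen_a gen_b.
Proof. by exists idfun, idfun. Qed.

(** Nielsen moves: [nu] and [mu] are mutually inverse because they are so on the generators, and the
    new basis is the image of the generators under [phi \o nu]. *)
Lemma is_basis_trans (x y x' y' : F2) (nu mu : {multiplicative F2 -> F2}) :
  is_basis x y ->
  nu (mu gen_a) = gen_a -> nu (mu gen_b) = gen_b ->
  mu (nu gen_a) = gen_a -> mu (nu gen_b) = gen_b ->
  (forall phi : {multiplicative F2 -> F2}, phi gen_a = x -> phi gen_b = y ->
    phi (nu gen_a) = x' /\ phi (nu gen_b) = y') ->
  is_basis x' y'.
Proof.
move=> [phi [psi [phiK psiK pa pb]]] nma nmb mna mnb /(_ phi pa pb)[xE yE].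
exists (phi \o nu), (mu \o psi); split=> // g /=.
  by rewrite phiK; apply: (F2_hom_id (phi := mu \o nu)).
by rewrite [nu (mu _)](F2_hom_id (phi := nu \o mu)).
Qed.

Lemma is_basisC x y : is_basis x y -> is_basis y x.
Proof.
move=> H; apply: (is_basis_trans (nu := F2_lift gen_b gen_a)
  (mu := F2_lift gen_b gen_a) H) => [||||phi <- <-];
  by rewrite !(F2_lift_a, F2_lift_b).
Qed.

Lemma is_basisVr x y : is_basis x y -> is_basis x y^-1%g.
Proof.
move=> H; apply: (is_basis_trans (nu := F2_lift gen_a gen_b^-1%g)
  (mu := F2_lift gen_a gen_b^-1%g) H) => [||||phi <- <-];
  by rewrite !(multiplicativeV, F2_lift_a, F2_lift_b, invgK).
Qed.

Lemma is_basis_mulV x y : is_basis x y -> is_basis (x * y^-1)%g y.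
Proof.
move=> H; apply: (is_basis_trans (nu := F2_lift (gen_a * gen_b^-1)%g gen_b)
  (mu := F2_lift (gen_a * gen_b)%g gen_b) H) => [||||phi <- <-];
  by rewrite !(gmulfM, multiplicativeV, F2_lift_a, F2_lift_b, mulgK, mulgVK).
Qed.

Lemma commutator_mulV (G : groupType) (x y : G) :
  commutator (x * y^-1)%g y = commutator x y.
Proof. by rewrite /commutator !gnorm. Qed.

Lemma is_basis_neq1 x y : is_basis x y -> x <> 1%g.
Proof.
move=> [phi [psi [phiK _ <- _]]] /(congr1 psi); rewrite phiK multiplicative1.
by move=> /(congr1 val).
Qed.

End Bases.

(** * Euclid's algorithm on bases *)

Section Descent.
Variables (R : realType) (Lambda : zmodClosed R) (len : F2 -> R).
Hypothesis len_pl : pseudo_length Lambda len.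
Hypothesis len_hyp : purely_hyperbolic len.

Definition ex_reduced_basis := exists x y, is_basis x y /\ reduced_pair len x y.

Let c := len (commutator gen_a gen_b).

Definition comm_basis x y := is_basis x y /\ len (commutator x y) = c.

Lemma comm_basisC x y : comm_basis x y -> comm_basis y x.
Proof.
by move=> [/is_basisC bxy cxy]; split=> //; rewrite (plen_commV len_pl).
Qed.

Lemma comm_basis_gt0 x y : comm_basis x y -> 0 < len x.
Proof. by case=> /is_basis_neq1 + _; apply: len_hyp. Qed.

Lemma descent_step x y : comm_basis x y -> len y <= len x ->
  ex_reduced_basis \/
  c <= 2 * len x /\ exists x', comm_basis x' y /\ len x' <= len x - len y.
Proof.
move=> [bxy cxy] yx; case: (boolP (reduced_pair len x y)) => [H|].
  by left; exists x, y.
rewrite /reduced_pair ger0_norm ?subr_ge0 // -leNgt ge_min => /orP[H|H]; right.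
  (* Passing to [xy] is the move for the basis [x], [y^-1], whose commutator has the same length. *)
  rewrite -cxy -(plen_comm_Vr len_pl); split.
    by rewrite (plen_comm_le len_pl) // invgK (plenV len_pl).
  exists (x * y)%g; split=> //; split.
    by rewrite -[y]invgK; exact/is_basisVr/is_basis_mulV/is_basisVr.
  rewrite -cxy -(plen_comm_Vr len_pl) -{1}[y]invgK commutator_mulV.
  exact: plen_comm_Vr len_pl _ _.
split; first by rewrite -cxy (plen_comm_le len_pl).
exists (x * y^-1)%g; split=> //; split; first exact: is_basis_mulV.
by rewrite commutator_mulV.
Qed.

(* The larger length stays above [c / 2], so a smaller length below [c / 2] is
   never touched by the descent. *)
Lemma descent_small n x y : comm_basis x y -> len y < c / 2 ->
  len x <= n%:R * len y -> ex_reduced_basis.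
Proof.
elim: n x => [|n IH] x bxy yc xn.
  by have := comm_basis_gt0 bxy; rewrite mul0r in xn; lra.
have [xy|yx] := ltP (len x) (len y).
  have [//|[H _]] := descent_step (comm_basisC bxy) (ltW xy); lra.
have [//|[H [x' [bx' Hx']]]] := descent_step bxy yx.
by apply: (IH x') => //; rewrite -addn1 natrD mulrDl mul1r in xn; lra.
Qed.

Lemma archimedean_mul (p q : R) : 0 < q -> exists n : nat, p <= n%:R * q.
Proof.
move=> q0; exists (Num.bound `|p / q|); rewrite -ler_pdivrMr //.
exact/ltW/(le_lt_trans (ler_norm _))/archi_boundP/normr_ge0.
Qed.

(** While the smaller length is at least [c / 2], each step lowers the sum of the two lengths by at
    least [c / 2]; otherwise [descent_small] takes over. *)
Lemma descent_large n x y : comm_basis x y -> 0 < c ->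
  len x + len y <= n%:R * (c / 2) -> ex_reduced_basis.
Proof.
move=> + c0.
have small z t : comm_basis z t -> len t < c / 2 -> ex_reduced_basis.
  move=> bzt tc; have t0 := comm_basis_gt0 (comm_basisC bzt).
  by have [k] := archimedean_mul (len z) t0; apply: descent_small.
elim: n x y => [|n IH] x y bxy.
  have := comm_basis_gt0 bxy; have := comm_basis_gt0 (comm_basisC bxy).
  by rewrite mul0r; lra.
have step z t : comm_basis z t -> len t <= len z ->
    len z + len t <= n.+1%:R * (c / 2) -> ex_reduced_basis.
  move=> bzt tz; rewrite -addn1 natrD mulrDl mul1r => zt.
  have [tc|tc] := ltP (len t) (c / 2); first exact: small bzt tc.
  have [//|[H [z' [bz' Hz']]]] := descent_step bzt tz.
  by apply: (IH z' t) => //; lra.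
move=> xyn; have [xy|yx] := leP (len x) (len y).
  by apply: (step y x) => //; [exact: comm_basisC | lra].
by apply: (step x y) => //; exact: ltW.
Qed.

Lemma reduced_basis_exists : ex_reduced_basis.
Proof.
have c0 : 0 < c.
  (* The commutator of the generators computes to a nonempty reduced word. *)
  by apply: len_hyp => /(congr1 val).
have [|n] := archimedean_mul (len gen_a + len gen_b) (q := c / 2); first lra.
by apply: descent_large => //; split; first exact: is_basis_gen.
Qed.

End Descent.

(** * Uniqueness for admissible parameters, and admissibility of reduced bases *)

Section Admissible.
Variables (R : realType) (Lambda : zmodClosed R).

(** The constants are chosen before [len], so that two pseudo-lengths with the same four values obey
    the same formula. *)
Lemma plen_formula (alpha beta gamma delta : R) :
  admissible Lambda alpha beta gamma delta ->
  exists C D E, forall len : F2 -> R, pseudo_length Lambda len ->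
    len gen_a = alpha -> len gen_b = beta ->
    len (gen_a * gen_b)%g = gamma -> len (gen_a * gen_b^-1)%g = delta ->
  forall w, cyclically_reduced w ->
    len (word_val w) = cyclic_wt alpha beta C D E w.
Proof.
move=> [_ max2 [a0 b0]].
rewrite lt_min !ltr_norml => /andP[/andP[g1 g2] /andP[d1 d2]].
pose C := (gamma - alpha - beta) / 2; pose D := (delta - alpha - beta) / 2.
(* By condition (2), either [C = D > 0] and [E = 0], or the larger of [C] and [D] is 0 and [E] is
   minus the other; then [E < alpha] and [E < beta] restate the last inequality of (3). *)
have [E [[E0 Ea Eb] [EC ED ECD CD DC]]] : exists E : R,
    [/\ 0 <= E, E < alpha & E < beta] /\
    [/\ - E <= C, - E <= D, - E <= C + D, C - D <= E & D - C <= E].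
  rewrite /C /D; case: max2 => [[<- H]|].
    by exists 0; split; split; lra.
  rewrite maxEle; case: ifPn => [H dE|].
    by exists ((alpha + beta - gamma) / 2); split; split; lra.
  rewrite -ltNge => H gE.
  by exists ((alpha + beta - delta) / 2); split; split; lra.
exists C, D, E => len pl la lb lab laVb w.
apply: (plen_word E0 Ea Eb EC ED ECD CD DC pl la lb _ _ w).1.
- by rewrite lab /C; lra.
- by rewrite laVb /D; lra.
Qed.

(** Here [len] itself witnesses existence, so [xget] does not return its default value. *)
Lemma length_of_eq (alpha beta gamma delta : R) (len : F2 -> R) :
  admissible Lambda alpha beta gamma delta -> pseudo_length Lambda len ->
  len gen_a = alpha -> len gen_b = beta ->
  len (gen_a * gen_b)%g = gamma -> len (gen_a * gen_b^-1)%g = delta ->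
  length_of Lambda alpha beta gamma delta = len.
Proof.
move=> /plen_formula[C [D [E formula]]] pl la lb lab laVb.
apply: xget_unique => //= len' [pl' [la' lb' lab' laVb']].
apply/funext => g; have [k [w [cw ->]]] := conj_cyclically_reduced g.
by rewrite (pl_A1 pl) (pl_A1 pl') !formula.
Qed.

Lemma pseudo_length_comp (G H : groupType) (phi : {multiplicative G -> H})
    (len : H -> R) :
  pseudo_length Lambda len -> pseudo_length Lambda (len \o phi).
Proof.
move=> pl; split=> [g|g|g h|g h|g h|g h] /=.
- exact: (pl_in pl).
- exact: (pl_ge0 pl).
- by rewrite gmulfM; apply: (pl_A0 pl).
- by rewrite !gmulfM multiplicativeV (pl_A1 pl).
- by rewrite !gmulfM multiplicativeV; apply: (pl_A2 pl).
- by rewrite !gmulfM multiplicativeV; apply: (pl_A3 pl).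
Qed.

Lemma in_doubleD (p q : R) :
  in_double Lambda p -> in_double Lambda q -> in_double Lambda (p + q).
Proof.
by move=> [p' p'L ->] [q' q'L ->]; exists (p' + q'); rewrite ?rpredD ?mulrDr.
Qed.

Lemma in_doubleN (p : R) : in_double Lambda p -> in_double Lambda (- p).
Proof. by move=> [p' p'L ->]; exists (- p'); rewrite ?rpredN ?mulrN. Qed.

Lemma admissible_reduced (G : groupType) (len : G -> R) (x y : G) :
  pseudo_length Lambda len -> 0 < len x -> 0 < len y ->
  reduced_pair len x y ->
  admissible Lambda (len x) (len y) (len (x * y)%g) (len (x * y^-1)%g).
Proof.
move=> pl x0 y0 good; split; [|exact: (pl_A3 pl)|by []].
have lenL := pl_in pl.
move: good; rewrite /reduced_pair lt_min !ltr_norml.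
move=> /andP[/andP[g1 g2] /andP[d1 d2]].
have conj0 : 0 < len (y * x * y^-1)%g by rewrite (pl_A1 pl).
have A0xy := pl_A0 pl x0 y0.
(* When |xy| or |xy^-1| is less than |x| + |y|, condition (A0) for the pair
   x, y says nothing; the parity comes from the pair x, yxy^-1. *)
have A0c := pl_A0 pl x0 conj0.
rewrite (pl_A1 pl) in A0c.
have double z : in_double Lambda (2 * len z) by exists (len z).
have zero : in_double Lambda 0 by exists 0; rewrite ?rpred0 ?mulr0.
have eqin p q : q = p -> in_double Lambda p -> in_double Lambda q by move=> ->.
have lt_y : 2 * len y < len (x * y)%g + len (x * y^-1)%g.
  by case: (plen_max_eq pl x0 y0) => -[H1 H2]; lra.
rewrite (plen_conj_mul pl) // in A0c; [|lra|lra].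
case: (plen_max_eq pl x0 y0) => -[H1 H2].
- by rewrite -H1 max_r in A0xy *; [split|lra].
- split; first by apply: eqin zero; rewrite H1; lra.
  (* The excess is [|xy^-1| + |y| - |x|], positive since the pair is reduced; subtracting [2 |y|]
     leaves [|xy^-1| - |x| - |y|]. *)
  rewrite max_r in A0c; last by lra.
  apply: eqin (in_doubleD A0c (in_doubleN (double y))).
  by rewrite H1; lra.
split; last by apply: eqin zero; rewrite H1; lra.
rewrite max_r in A0c; last by lra.
apply: eqin (in_doubleD A0c (in_doubleN (double y))).
by rewrite H1; lra.
Qed.

End Admissible.

Theorem theorem4p6 (R : realType) (Lambda : zmodClosed R)
    (Lambda_neq0 : ~ (Lambda =i pred1 (0 : R)))
    (len : F2 -> R) (len_pl : pseudo_length Lambda len)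
    (len_hyp : purely_hyperbolic len) :
  exists (sigma : {multiplicative F2 -> F2}) (alpha beta gamma delta : R),
    [/\ bijective sigma,
        [/\ alpha \in Lambda, beta \in Lambda, gamma \in Lambda
          & delta \in Lambda],
        admissible Lambda alpha beta gamma delta
      & forall w : F2, len w = length_of Lambda alpha beta gamma delta (sigma w)].
Proof.
have [x [y [bxy red]]] := reduced_basis_exists len_pl len_hyp.
have x0 := len_hyp _ (is_basis_neq1 bxy).
have y0 := len_hyp _ (is_basis_neq1 (is_basisC bxy)).
have adm := admissible_reduced len_pl x0 y0 red.
have [phi [psi [phiK psiK pa pb]]] := bxy.
(* As [phi] sends the generators to [x] and [y], these are the four values of [len \o phi]; hence
   [sigma] is the inverse of [phi]. *)
exists psi, (len x), (len y), (len (x * y)%g), (len (x * y^-1)%g).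
split=> // [||w]; first by exists phi.
  by split; apply: (pl_in len_pl).
rewrite (length_of_eq (len := len \o phi) adm) /=
  ?gmulfM ?multiplicativeV ?pa ?pb //; first by rewrite psiK.
exact: pseudo_length_comp.
Qed.
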